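(* Let $p>1$. Let $g:\mathbb{R}^n\to\mathbb{R}\cup\{+\infty\}$ be proper, lower semicontinuous, and high-order prox-bounded of order $p$ with threshold $\gamma^{g,p}>0$. Let $f:\mathbb{R}^n\to\mathbb{R}$ be Fréchet differentiable, let $\varphi:=f+g$, let $\overline{x}\in\mathbb{R}^n$ with $\varphi(\overline{x})<+\infty$, and suppose that $f\in\mathcal{C}^2(U)$ for some open neighborhood $U$ of $\overline{x}$. Then, for each $\gamma\in(0,\gamma^{g,p})$, $$\partial\varphi_\gamma^p(\overline{x})\subseteq\bigcup_{\overline{y}\in\mathbf{T}_{\gamma\varphi}^{p}(\overline{x})}\left\{\nabla^2f(\overline{x})(\overline{y}-\overline{x})+\frac{1}{\gamma}\|\overline{x}-\overline{y}\|^{p-2}(\overline{x}-\overline{y})\right\}.$$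
   Context: $\|\cdot\|$ and $\langle\cdot,\cdot\rangle$ are the Euclidean norm and inner product on $\mathbb{R}^n$. The expression $\|z\|^{p-2}z$ is understood as $0$ when $z=0$. A function $h:\mathbb{R}^n\to\mathbb{R}\cup\{+\infty\}$ is proper if it is finite at some point. $\mathcal{C}^2(U)$ denotes the functions that are twice continuously differentiable on $U$. A proper function $g$ is high-order prox-bounded of order $p>1$ if there exist $\gamma>0$ and $x\in\mathbb{R}^n$ with $\inf_{y\in\mathbb{R}^n}\{g(y)+\frac{1}{p\gamma}\|x-y\|^p\}>-\infty$; the supremum of all such $\gamma$ is the threshold $\gamma^{g,p}\in(0,+\infty]$. For $\gamma>0$, the high-order forward-backward envelope and splitting mapping of $\varphi=f+g$ are, respectively, the infimum $\varphi_\gamma^p(x)$ and the set of minimizers $\mathbf{T}_{\gamma\varphi}^{p}(x)$ over $y\in\mathbb{R}^n$ of $$y\mapsto f(x)+\langle\nabla f(x),y-x\rangle+g(y)+\frac{1}{p\gamma}\|x-y\|^p.$$ For $\psi:\mathbb{R}^n\to\mathbb{R}\cup\{+\infty\}$ and $\overline{x}$ with $\psi(\overline{x})$ finite, the Fréchet (regular) subdifferential is $$\widehat{\partial}\psi(\overline{x}):=\left\{\zeta\in\mathbb{R}^n\;\middle|\;\liminf_{x\to\overline{x}}\frac{\psi(x)-\psi(\overline{x})-\langle\zeta,x-\overline{x}\rangle}{\|x-\overline{x}\|}\ge 0\right\},$$ and the Mordukhovich (limiting) subdifferential $\partial\psi(\overline{x})$ is the set of $\zeta\in\mathbb{R}^n$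 for which there exist $x^k\to\overline{x}$ and $\zeta^k\in\widehat{\partial}\psi(x^k)$ with $\psi(x^k)\to\psi(\overline{x})$ and $\zeta^k\to\zeta$. *)

(* Defs.v *)
From mathcomp Require Import all_boot all_order all_algebra.
From mathcomp Require Import all_classical all_reals all_analysis.

Set Implicit Arguments.
Unset Strict Implicit.
Unset Printing Implicit Defensive.

Import Order.TTheory GRing.Theory Num.Theory.
Import numFieldNormedType.Exports.

Local Open Scope classical_set_scope.
Local Open Scope ring_scope.

Section Defs.
Context {R : realType} {n : nat}.
Implicit Types (x y z v zeta : 'rV[R]_n) (f : 'rV[R]_n -> R)
  (g psi : 'rV[R]_n -> \bar R) (p gamma : R).

(* R^n is 'rV[R]_n. The library norm on 'rV[R]_n is the max norm; it gives the
   same topology and the same (Frechet) differentials as the Euclidean norm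
   below, so only the topology and differentials of the library are used. *)
Definition dotp x y : R := \sum_(i < n) x 0 i * y 0 i.
Definition enorm x : R := Num.sqrt (dotp x x).

(* The vector representing the Frechet differential 'd f x through dotp. *)
Definition grad f x : 'rV[R]_n := \row_i 'd f x (delta_mx 0 i).

(* Vectors are rows, so the Hessian acts on v as v *m hess f x, which is
   'd (grad f) x v when grad f is differentiable at x. *)
Definition hess f x : 'M[R]_n := 'J (grad f) x.

(* Meant for open U. *)
Definition C2_on (U : set 'rV[R]_n) f : Prop :=
  forall x, U x -> [/\ differentiable f x, differentiable (grad f) x
                     & {for x, continuous (hess f)}].

Definition proper_fun g : Prop := exists x, g x \is a fin_num.

Definition prox_bounded_at p g gamma : Prop :=
  0 < gamma /\ exists x,
    (-oo < ereal_inf [set g y + ((p * gamma)^-1 * enorm (x - y) `^ p)%:E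
                     | y in setT])%E.

Definition prox_bounded p g : Prop := exists gamma, prox_bounded_at p g gamma.

Definition prox_threshold p g : \bar R :=
  ereal_sup [set gamma%:E | gamma in prox_bounded_at p g].

Definition fb_model p gamma f g x y : \bar R :=
  ((f x + dotp (grad f x) (y - x))%:E + g y
   + ((p * gamma)^-1 * enorm (x - y) `^ p)%:E)%E.

Definition fb_envelope p gamma f g x : \bar R :=
  ereal_inf [set fb_model p gamma f g x y | y in setT].

Definition fb_splitting p gamma f g x : set 'rV[R]_n :=
  [set y | forall z, (fb_model p gamma f g x y <= fb_model p gamma f g x z)%E].

(* Equals 0 at z = 0, whatever the value of 0 `^ (p - 2). *)
Definition pow_dual p z : 'rV[R]_n := enorm z `^ (p - 2) *: z.

Definition frechet_subdiff psi x : set 'rV[R]_n :=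
  [set zeta | psi x \is a fin_num /\
    (0 <= limf_einf
       (fun y => (psi y - psi x - (dotp zeta (y - x))%:E)
                 * ((enorm (y - x))^-1)%:E) x^')%E].

Definition limiting_subdiff psi x : set 'rV[R]_n :=
  [set zeta | psi x \is a fin_num /\
    exists (xk zetak : nat -> 'rV[R]_n),
      [/\ xk @ \oo --> x,
          forall k, frechet_subdiff psi (xk k) (zetak k),
          psi \o xk @ \oo --> psi x
        & zetak @ \oo --> zeta]].

End Defs.

(* Main.v *)
(* Let zeta be the limit of Frechet subgradients zeta_k at x_k -> xbar, and let
   y_k minimize the model at x_k. The model x |-> M(x, y_k) majorizes the
   envelope with equality at x_k, so along any line through x_k the subgradient
   inequality passes to M(., y_k). Comparing directional derivatives gives
     zeta_k = (y_k - x_k) H_k^T + gamma^-1 |x_k - y_k|^(p-2) (x_k - y_k),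
   H_k the Hessian at x_k; the term |x - y|^p is handled by convexity and the
   continuity of z |-> |z|^(p-2) z, which avoids treating z = 0 separately.
   Since gamma is below the threshold the model is coercive, uniformly for x in
   bounded sets, so (y_k) is bounded; by lower semicontinuity of g its cluster
   points minimize the model at xbar, and the formula passes to the limit. The
   Hessian is symmetric at xbar by Schwarz' theorem. Cluster points are taken as
   limits along one ultrafilter on nat, which replaces subsequences. *)
Require Import Defs.
From mathcomp Require Import all_boot all_order all_algebra.
From mathcomp Require Import all_classical all_reals all_analysis.
From mathcomp Require Import ring lra.

Set Implicit Arguments.
Unset Strict Implicit.
Unset Printing Implicit Defensive.

Import Order.TTheory GRing.Theory Num.Theory.
Import numFieldNormedType.Exports.

Local Open Scope classical_set_scope.
Local Open Scope ring_scope.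

(** * Limits of finite sums and of matrix products *)

Lemma cvg_finsum (R : numFieldType) (V : normedModType R) (I : finType)
    (T : Type) (F : set_system T) {FF : Filter F} (h : I -> T -> V) (l : I -> V) :
  (forall i, h i @ F --> l i) ->
  (fun j => \sum_i h i j) @ F --> \sum_i l i.
Proof.
move=> hl; elim: (index_enum I) => [|i s IHs].
  by under eq_fun do rewrite big_nil; rewrite big_nil; exact: cvg_cst.
by under eq_fun do rewrite big_cons; rewrite big_cons; exact: cvgD.
Qed.

Lemma cvg_coord (R : realType) (m n : nat) (T : Type) (F : set_system T)
    {FF : Filter F} (h : T -> 'M[R]_(m, n)) (l : 'M[R]_(m, n)) i k :
  h @ F --> l -> (fun j => h j i k) @ F --> l i k.
Proof.
move=> hl; apply: (@continuous_cvg _ _ _ _ _ _ (fun M : 'M[R]_(m, n) => M i k)) => //.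
exact: coord_continuous.
Qed.

(** The transposed second factor serves two uses: [dotp x y] is the entry of [x *m y^T], and the
    subgradient formula contains [(y - x) *m H^T]. *)
Lemma cvg_mulmx_trmx (R : realType) (m n q : nat) (T : Type)
    (F : set_system T) {FF : Filter F} (a : T -> 'M[R]_(m, n))
    (b : T -> 'M[R]_(q, n)) (x : 'M[R]_(m, n)) (y : 'M[R]_(q, n)) i k :
  a @ F --> x -> b @ F --> y ->
  (fun j => (a j *m (b j)^T) i k) @ F --> (x *m y^T) i k.
Proof.
move=> ax by_; under eq_fun do rewrite mxE; rewrite mxE.
apply: cvg_finsum => l; under eq_fun do rewrite mxE; rewrite mxE.
by apply: (@cvgM _ _ _ _ (fun j => a j i l) (fun j => b j k l)); exact: cvg_coord.
Qed.

(** * Euclidean inner product and norm, compared with the max norm *)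

Section Euclidean.
Context {R : realType} {n : nat}.
Implicit Types (x y z v : 'rV[R]_n) (p t : R).

Lemma dotpE x y : dotp x y = (x *m y^T) 0 0.
Proof. by rewrite mxE; apply: eq_bigr => i _; rewrite mxE. Qed.

Lemma dotpC x y : dotp x y = dotp y x.
Proof. by apply: eq_bigr => i _; rewrite mulrC. Qed.

Lemma dotpDl x y z : dotp (x + y) z = dotp x z + dotp y z.
Proof. by rewrite !dotpE mulmxDl mxE. Qed.

Lemma dotpZl t x y : dotp (t *: x) y = t * dotp x y.
Proof. by rewrite !dotpE -scalemxAl mxE. Qed.

Lemma dotpNl x y : dotp (- x) y = - dotp x y.
Proof. by rewrite -scaleN1r dotpZl mulN1r. Qed.

Lemma dotpBl x y z : dotp (x - y) z = dotp x z - dotp y z.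
Proof. by rewrite dotpDl dotpNl. Qed.

Lemma dotpDr x y z : dotp x (y + z) = dotp x y + dotp x z.
Proof. by rewrite !(dotpC x) dotpDl. Qed.

Lemma dotpZr t x y : dotp x (t *: y) = t * dotp x y.
Proof. by rewrite !(dotpC x) dotpZl. Qed.

Lemma dotpNr x y : dotp x (- y) = - dotp x y.
Proof. by rewrite !(dotpC x) dotpNl. Qed.

Lemma dotpBr x y z : dotp x (y - z) = dotp x y - dotp x z.
Proof. by rewrite dotpDr dotpNr. Qed.

Lemma dotp0r x : dotp x 0 = 0.
Proof. by rewrite -(scale0r 0) dotpZr mul0r. Qed.

Lemma dotp_mulmx v y (A : 'M[R]_n) : dotp (v *m A) y = dotp v (y *m A^T).
Proof. by rewrite !dotpE trmx_mul trmxK mulmxA. Qed.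

Lemma dotp_delta x i : dotp x (delta_mx 0 i) = x 0 i.
Proof.
rewrite /dotp (bigD1 i)//= big1 ?addr0 => [|j ji].
  by rewrite mxE !eqxx mulr1.
by rewrite mxE (negbTE ji) andbF mulr0.
Qed.

(** An inequality is enough because [v] may be replaced by [- v]; comparing directional derivatives
    produces only one-sided bounds. *)
Lemma dotp_inj x y : (forall v, dotp x v <= dotp y v) -> x = y.
Proof.
move=> h; apply/rowP => i; apply/eqP; rewrite eq_le -!dotp_delta h /=.
by have := h (- delta_mx 0 i); rewrite !dotpNr lerN2.
Qed.

Lemma dotp_ge0 x : 0 <= dotp x x.
Proof. by apply: sumr_ge0 => i _; rewrite -expr2 sqr_ge0. Qed.

Lemma enorm_ge0 x : 0 <= enorm x.
Proof. exact: sqrtr_ge0. Qed.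

Lemma sqr_enorm x : enorm x ^+ 2 = dotp x x.
Proof. by rewrite sqr_sqrtr ?dotp_ge0. Qed.

Lemma ler_coord_enorm x i : `|x 0 i| <= enorm x.
Proof.
rewrite -(@ler_pXn2r _ 2) ?nnegrE ?enorm_ge0 ?normr_ge0//.
rewrite sqr_enorm real_normK ?num_real// /dotp (bigD1 i)//= -expr2 lerDl.
by apply: sumr_ge0 => j _; rewrite -expr2 sqr_ge0.
Qed.

Lemma ler_norm_enorm x : `|x| <= enorm x.
Proof.
rewrite [leLHS]/Num.norm /= mx_normrE.
apply/bigmax_leP; split=> [|[i j] _]/=; first exact: enorm_ge0.
by rewrite ord1 ler_coord_enorm.
Qed.

Lemma enorm0 : enorm (0 : 'rV[R]_n) = 0.
Proof. by rewrite /enorm dotp0r sqrtr0. Qed.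

Lemma enorm0_eq0 x : enorm x = 0 -> x = 0.
Proof.
move=> x0; apply/eqP; rewrite -normr_le0; apply: le_trans (ler_norm_enorm x) _.
by rewrite x0.
Qed.

Lemma enormZ t x : enorm (t *: x) = `|t| * enorm x.
Proof.
by rewrite /enorm dotpZl dotpZr mulrA -expr2 sqrtrM ?sqr_ge0// sqrtr_sqr.
Qed.

Lemma enormN x : enorm (- x) = enorm x.
Proof. by rewrite -scaleN1r enormZ normrN1 mul1r. Qed.

Lemma dotp_le_enorm x y : dotp x y <= enorm x * enorm y.
Proof.
have [y0|y0] := eqVneq (enorm y) 0.
  by rewrite (enorm0_eq0 y0) dotp0r enorm0 mulr0.
have y_gt0 : 0 < enorm y ^+ 2 by rewrite exprn_gt0// lt_def y0 enorm_ge0.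
apply: le_trans (ler_norm _) _.
rewrite -(@ler_pXn2r _ 2) ?nnegrE ?mulr_ge0 ?enorm_ge0 ?normr_ge0//.
rewrite real_normK ?num_real// exprMn -subr_ge0 -(pmulr_rge0 _ y_gt0).
(* The goal now carries an extra factor [enorm y ^+ 2], which makes it the expanded square of this
   vector, a multiple of the component of [x] orthogonal to [y]. *)
have := dotp_ge0 (enorm y ^+ 2 *: x - dotp x y *: y).
rewrite !(dotpBl, dotpBr, dotpZl, dotpZr) (dotpC y x) -!sqr_enorm.
by congr (0 <= _); ring.
Qed.

Lemma ler_enormD x y : enorm (x + y) <= enorm x + enorm y.
Proof.
rewrite -(@ler_pXn2r _ 2) ?nnegrE ?addr_ge0 ?enorm_ge0//.
rewrite sqrrD !sqr_enorm dotpDl !dotpDr (dotpC y x).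
have := dotp_le_enorm x y; lra.
Qed.

Lemma cvg_dotp (T : Type) (F : set_system T) {FF : Filter F}
    (a b : T -> 'rV[R]_n) x y :
  a @ F --> x -> b @ F --> y -> (fun j => dotp (a j) (b j)) @ F --> dotp x y.
Proof.
by move=> ax by_; under eq_fun do rewrite dotpE; rewrite dotpE; exact: cvg_mulmx_trmx.
Qed.

Lemma cvg_enorm (T : Type) (F : set_system T) {FF : Filter F}
    (a : T -> 'rV[R]_n) x : a @ F --> x -> (enorm \o a) @ F --> enorm x.
Proof.
move=> ax.
apply: (@continuous_cvg _ _ _ _ _ (fun j => dotp (a j) (a j)) Num.sqrt);
  by [exact: sqrt_continuous | exact: cvg_dotp].
Qed.

Lemma cvg_enormB (T : Type) (F : set_system T) {FF : Filter F}
    (a b : T -> 'rV[R]_n) x y :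
  a @ F --> x -> b @ F --> y -> (fun j => enorm (a j - b j)) @ F --> enorm (x - y).
Proof. by move=> ax by_; apply: (@cvg_enorm _ _ _ (a \- b)); exact: cvgB. Qed.

End Euclidean.

(** * Real powers, the map [z |-> |z|^(p-2) z], and a growth estimate *)

Lemma cvg_powR (R : realType) (T : Type) (F : set_system T) {FF : Filter F}
    (h : T -> R) (l r : R) :
  0 < r -> (forall j, 0 <= h j) -> 0 <= l ->
  h @ F --> l -> (fun j => h j `^ r) @ F --> l `^ r.
Proof.
move=> r0 h0; rewrite le_eqVlt => /predU1P[<- hl|l0 hl]; last first.
  apply: (@continuous_cvg _ _ _ _ _ _ (fun a => a `^ r)) => //.
  apply/differentiable_continuous/derivable1_diffP.
  by apply: derivable_powR; rewrite in_itv/= l0.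
(* At the limit 0 the power may fail to be differentiable; there [h j < e^(1/r)] gives
   [h j ^ r < e]. *)
rewrite powR0 ?gt_eqF//; apply/cvgrPdist_lt => e e0.
have e'0 : 0 < e `^ r^-1 by rewrite powR_gt0.
move/cvgrPdist_lt: hl => /(_ _ e'0); apply: filterS => j.
rewrite !sub0r !normrN ger0_norm// ger0_norm ?powR_ge0// => hj.
rewrite -[ltRHS]powRr1 ?ltW// -(mulVf (lt0r_neq0 r0)) powRrM.
by apply: gt0_ltr_powR; rewrite ?nnegrE ?h0 ?powR_ge0.
Qed.

Section PowDual.
Context {R : realType} {n : nat}.
Implicit Types (p : R) (a b x : 'rV[R]_n).

Lemma enorm_pow_dual p x : 1 < p -> enorm (pow_dual p x) = enorm x `^ (p - 1).
Proof.
move=> p1; rewrite enormZ ger0_norm ?powR_ge0//.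
have [->|x0] := eqVneq (enorm x) 0.
  by rewrite mulr0 powR0// subr_eq0 gt_eqF.
rewrite -{2}(powRr1 (enorm_ge0 x)) -powRD ?x0 ?implybT//; congr (_ `^ _); ring.
Qed.

Lemma dotp_pow_dual p x : 1 < p -> dotp (pow_dual p x) x = enorm x `^ p.
Proof.
move=> p1; rewrite dotpZl -sqr_enorm.
have p0 : 0 < p by lra.
have [->|x0] := eqVneq (enorm x) 0.
  by rewrite expr0n mulr0 powR0 ?gt_eqF.
rewrite -powR_mulrn ?enorm_ge0// -powRD ?x0 ?implybT//; congr (_ `^ _); ring.
Qed.

Lemma cvg_pow_dual (T : Type) (F : set_system T) {FF : Filter F}
    p (a : T -> 'rV[R]_n) x :
  1 < p -> a @ F --> x -> (fun j => pow_dual p (a j)) @ F --> pow_dual p x.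
Proof.
move=> p1 ax; have nax : enorm \o a @ F --> enorm x by exact: cvg_enorm.
have [x0|x0] := eqVneq (enorm x) 0; last first.
  apply: (cvgZ (s := fun j => enorm (a j) `^ (p - 2))) => //.
  apply: (@continuous_cvg _ _ _ _ _ (enorm \o a) (fun s => s `^ (p - 2))) => //.
  apply/differentiable_continuous/derivable1_diffP.
  by apply: derivable_powR; rewrite in_itv/= andbT lt_def x0 enorm_ge0.
(* For [p < 2] the factor [|z|^(p-2)] blows up near 0, so the limit 0 is obtained from the norm
   [|z|^(p-1)] of the whole vector. *)
rewrite (enorm0_eq0 x0) /pow_dual scaler0.
apply/norm_cvg0P.
apply: (@squeeze_cvgr _ _ _ _ (fun=> 0) (fun j => enorm (a j) `^ (p - 1))).
- by near=> j; rewrite normr_ge0/= -enorm_pow_dual// ler_norm_enorm.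
- exact: cvg_cst.
- have p10 : 0 < p - 1 by lra.
  have -> : 0 = enorm x `^ (p - 1) :> R by rewrite x0 powR0 ?gt_eqF.
  by apply: cvg_powR => //; [move=> j|]; exact: enorm_ge0.
Unshelve. all: by end_near. Qed.

(* Young's inequality *)
Lemma enorm_powR_convex p a b : 1 < p ->
  enorm b `^ p + p * dotp (pow_dual p b) (a - b) <= enorm a `^ p.
Proof.
move=> p_gt1; have p0 : 0 < p by lra.
have p1 : 0 < p - 1 by lra.
(* The pairing of [pow_dual p b] with [b] is [|b|^p], which leaves the pairing with [a]. It is
   bounded by Cauchy-Schwarz, then by Young with the exponent [p / (p - 1)] conjugate to [p]. *)
rewrite dotpBr dotp_pow_dual//.
have := dotp_le_enorm a (pow_dual p b); rewrite enorm_pow_dual// dotpC => ab.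
have q0 : 0 < p / (p - 1) by rewrite divr_gt0.
have pq : p^-1 + (p / (p - 1))^-1 = 1 by rewrite invf_div; field; rewrite gt_eqF.
have := conjugate_powR (enorm_ge0 a) (powR_ge0 (enorm b) (p - 1)) p0 q0 pq.
rewrite -powRrM (_ : (p - 1) * (p / (p - 1)) = p); last by field; rewrite gt_eqF.
move=> /(le_trans ab); rewrite -(ler_pM2l p0).
rewrite invf_div (_ : p * (_ + _) = enorm a `^ p + (p - 1) * enorm b `^ p); last first.
  by field; rewrite !gt_eqF.
move: (dotp _ _) (enorm _ `^ _) (enorm _ `^ _) => u s t; lra.
Qed.

End PowDual.

(* With l ^ p = c'' / c' > 1 and c'' halfway between c' and c, the bound
   s <= l * t holds as soon as t >= D / (l - 1), so the left-hand side of the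
   last hypothesis dominates (c - c'') t ^ p - G t. *)
Lemma powR_coercive (R : realType) (p c c' D G b : R) :
  1 < p -> 0 < c' < c -> 0 <= D -> 0 <= G -> 0 <= b ->
  exists B : R, forall s t : R, 0 <= s -> 0 <= t -> s <= t + D ->
    c * t `^ p <= b + G * t + c' * s `^ p -> t <= B.
Proof.
move=> p1 /andP[c'0 c'c] D0 G0 b0.
have p0 : 0 < p by lra.
pose c'' := (c + c') / 2; have c''0 : 0 < c'' by rewrite /c''; lra.
have cc'' : 0 < c - c'' by rewrite /c''; lra.
pose l := (c'' / c') `^ p^-1.
have l1 : 1 < l.
  have cc1 : 1 < c'' / c' by rewrite ltr_pdivlMr// mul1r /c''; lra.
  rewrite /l (_ : 1 = 1 `^ p^-1); last by rewrite powR1.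
  by apply: gt0_ltr_powR => //; rewrite ?nnegrE ?invr_gt0// ltW// (lt_trans ltr01).
have lp : c' * l `^ p = c''.
  rewrite /l -powRrM mulVf ?gt_eqF// powRr1; last by rewrite divr_ge0// ltW.
  by rewrite mulrC divfK ?gt_eqF.
pose B1 := D / (l - 1); pose B2 := ((b + G) / (c - c'')) `^ (p - 1)^-1.
have l10 : 0 < l - 1 by lra.
(* Beyond [B1] one has [s <= l * t]; [B2] solves [(c - c'') t^(p-1) = b + G]. The [+ 1] ensures
   [t >= 1], hence [b <= b * t]. *)
exists (B1 + 1 + B2) => s t s0 t0 st h.
have B10 : 0 <= B1 by rewrite divr_ge0// ltW.
have B20 : 0 <= B2 by exact: powR_ge0.
have [tB1|tB1] := leP t (B1 + 1); first by lra.
have t1 : 1 <= t by lra.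
have slt : s <= l * t.
  have : D <= (l - 1) * t by rewrite mulrC -ler_pdivrMr// -/B1; lra.
  lra.
have sp : s `^ p <= l `^ p * t `^ p.
  rewrite -powRM ?(ltW (lt_trans ltr01 l1))//.
  by apply: ge0_ler_powR; rewrite ?nnegrE ?(ltW p0)// mulr_ge0// ltW// (lt_trans ltr01).
have {}h : (c - c'') * t `^ p <= (b + G) * t.
  have : c' * s `^ p <= c'' * t `^ p by rewrite -lp -mulrA ler_pM2l.
  have : b * 1 <= b * t by rewrite ler_wpM2l.
  lra.
have tp1 : t `^ (p - 1) <= (b + G) / (c - c'').
  rewrite ler_pdivlMr// mulrC -(@ler_pM2r _ t); last by lra.
  by rewrite -mulrA (mulrC _ t) mulr_powRB1//; lra.
suff : t <= B2 by lra.
have p10 : 0 < p - 1 by lra.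
rewrite -[leLHS](powRr1 t0) -(mulfV (lt0r_neq0 p10)) powRrM.
by apply: ge0_ler_powR; rewrite ?nnegrE ?powR_ge0 ?(le_trans _ tp1) ?powR_ge0// invr_ge0 ltW.
Qed.

(** * Gradient, Hessian and Schwarz' theorem *)

Section Gradient.
Context {R : realType} {n : nat}.
Implicit Types (f : 'rV[R]_n -> R) (x u v w : 'rV[R]_n).

Lemma dotp_grad f x v : dotp (grad f x) v = 'd f x v.
Proof.
rewrite [in RHS](row_sum_delta v) linear_sum; apply: eq_bigr => i _.
by rewrite linearZ mxE mulrC.
Qed.

Lemma mulmx_hess f x v : v *m hess f x = 'd (grad f) x v.
Proof. exact: mul_rV_lin1. Qed.

(** Hoelder's inequality for the max norm and the l1 norm: the remainder in the expansion of
    [grad f] is measured in the max norm. *)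
Lemma dotp_le_norm u v : `|dotp u v| <= `|u| * \sum_i `|v 0 i|.
Proof.
rewrite mulr_sumr; apply: le_trans (ler_norm_sum _ _ _) _.
apply: ler_sum => i _; rewrite normrM ler_wpM2r//.
rewrite [leRHS]/Num.norm /= mx_normrE.
exact: (@le_bigmax _ _ _ 0 (fun i => `|u i.1 i.2|) (0, i)).
Qed.

Lemma differentiable_expansion (V W : normedModType R) (F : V -> W) (a : V) :
  differentiable F a -> forall e : R, 0 < e ->
  \forall h \near 0, `|F (a + h) - F a - 'd F a h| <= e * `|h|.
Proof.
move=> /diff_locally/eqaddoP dF e e0; have := dF e e0.
by apply: filterS => h /=; rewrite !fctE /= /cst opprD addrA (addrC a).
Qed.

Lemma is_derive_line f u v (s : R) : (forall y, differentiable f y) ->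
  is_derive s 1 (fun r => f (u + r *: v)) (dotp (grad f (u + s *: v)) v).
Proof.
move=> df.
have dl : is_diff s (fun r : R => u + r *: v) (fun r => r *: v).
  have := is_diffD (is_diff_cst u s) (is_diff_scalel s v).
  by rewrite add0r.
have dc : differentiable (f \o (fun r : R => u + r *: v)) s.
  by apply: differentiable_comp => //; exact: ex_diff.
split; first exact: diff_derivable.
rewrite deriveE// (diff_comp (ex_diff (is_diff_def := dl)) (df _)) /=.
by rewrite diff_val scale1r dotp_grad.
Qed.

(** The mean value theorem in the direction [v] turns the second difference into [t] times a
    difference of two gradients paired with [v]; both gradients are then expanded at [x]. *)
Lemma second_difference f x u v : (forall y, differentiable f y) ->
  differentiable (grad f) x -> forall e : R, 0 < e ->
  \forall t \near 0^'+,
    `|f (x + t *: u + t *: v) - f (x + t *: u) - f (x + t *: v) + f x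
      - t ^+ 2 * dotp (u *m hess f x) v| <= e * t ^+ 2.
Proof.
move=> df dg e e0.
pose S := \sum_i `|v 0 i|; pose N := `|u| + `|v|.
have S0 : 0 <= S by exact: sumr_ge0.
have N0 : 0 <= N by rewrite addr_ge0.
(* Each of the two expansion errors will be at most [e / K * (t * N) * S], so together they stay
   below [e * t]; the [+ 1] keeps [K] positive. *)
pose K := 2 * N * S + 1.
have K0 : 0 < K by rewrite ltr_wpDl// !mulr_ge0.
have eK0 : 0 < e / K by rewrite divr_gt0.
have /nbhs_ballP[d /= d0 hd] := differentiable_expansion dg eK0.
have dN0 : 0 < d / (N + 1) by rewrite divr_gt0// ltr_wpDl.
near=> t.
have t0 : 0 < t by near: t; exact: nbhs_right_gt.
have td : t * (N + 1) < d.
  by rewrite -ltr_pdivlMr ?ltr_wpDl//; near: t; exact: nbhs_right_lt.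
have small h : `|h| <= t * N ->
    `|dotp (grad f (x + h) - grad f x - h *m hess f x) v| <= e / K * (t * N) * S.
  move=> hN; apply: le_trans (dotp_le_norm _ _) _.
  rewrite ler_wpM2r// mulmx_hess (le_trans (hd h _))//; last first.
    by rewrite ler_wpM2l// ltW.
  rewrite /= -ball_normE /ball_ /= sub0r normrN (le_lt_trans hN)//.
  by apply: lt_trans td; rewrite ltr_pM2l// ltrDl.
pose F (s : R) := f (x + t *: u + s *: v) - f (x + s *: v).
pose dF (s : R) := dotp (grad f (x + t *: u + s *: v)) v
                   - dotp (grad f (x + s *: v)) v.
have FdF (s : R) : is_derive s 1 F (dF s).
  by apply: is_deriveB; exact: is_derive_line.
have [|s] := @MVT R F dF 0 t t0 (fun s _ => FdF s).
  apply: derivable_within_continuous => s _.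
  by case: (FdF s).
rewrite in_itv /= => /andP[s0 st]; rewrite subr0 /F !scale0r !addr0 => FE.
have -> : f (x + t *: u + t *: v) - f (x + t *: u) - f (x + t *: v) + f x
          = dF s * t.
  by rewrite -FE; ring.
have tu : `|t *: u| = t * `|u| by rewrite normrZ gtr0_norm.
have sv : `|s *: v| <= t * `|v| by rewrite normrZ gtr0_norm// ler_wpM2r// ltW.
have h1 : `|t *: u + s *: v| <= t * N.
  by apply: le_trans (ler_normD _ _) _; rewrite tu mulrDr lerD2l.
have h2 : `|s *: v| <= t * N.
  by rewrite (le_trans sv)// ler_wpM2l ?(ltW t0)// lerDr.
(* The unknown [s] drops out of the Hessian terms: those of [t *: u + s *: v] and [s *: v] differ by
   that of [t *: u]. *)
have -> : dF s * t - t ^+ 2 * dotp (u *m hess f x) v =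
  t * (dotp (grad f (x + (t *: u + s *: v)) - grad f x
             - (t *: u + s *: v) *m hess f x) v
       - dotp (grad f (x + s *: v) - grad f x - s *: v *m hess f x) v).
  rewrite /dF mulmxDl -!scalemxAl addrA.
  move: (u *m _) (v *m _) (grad f x) (grad f _) (grad f _) => a b c d1 d2.
  rewrite 4!dotpBl dotpDl 2!dotpZl; ring.
rewrite normrM gtr0_norm// expr2 mulrCA ler_pM2l//.
apply: le_trans (ler_normB _ _) _.
apply: le_trans (lerD (small _ h1) (small _ h2)) _.
have -> : e / K * (t * N) * S + e / K * (t * N) * S = (e * t) * ((2 * N * S) / K).
  by field; rewrite gt_eqF.
rewrite ler_piMr ?(mulr_ge0 (ltW e0) (ltW t0))//.
by rewrite ler_pdivrMr// mul1r /K lerDl.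
Unshelve. all: by end_near. Qed.

(** The second difference is symmetric in [u] and [v], so [t ^+ 2] times either bilinear form
    approximates the same number up to [e / 2 * t ^+ 2]. *)
Lemma hess_sym f x : (forall y, differentiable f y) ->
  differentiable (grad f) x -> (hess f x)^T = hess f x.
Proof.
move=> df dg.
suff H u v : dotp (u *m hess f x) v = dotp (v *m hess f x) u.
  apply/matrixP => i j; rewrite mxE.
  have := H (delta_mx 0 j) (delta_mx 0 i).
  by rewrite !dotp_delta -!rowE !mxE.
apply/eqP; rewrite -subr_eq0 -normr_le0; apply/ler_addgt0Pl => e e0.
have e20 : 0 < e / 2 by rewrite divr_gt0.
have [t [t0 h1 h2]] : exists t : R, [/\ 0 < t,
    `|f (x + t *: u + t *: v) - f (x + t *: u) - f (x + t *: v) + f x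
      - t ^+ 2 * dotp (u *m hess f x) v| <= e / 2 * t ^+ 2 &
    `|f (x + t *: v + t *: u) - f (x + t *: v) - f (x + t *: u) + f x
      - t ^+ 2 * dotp (v *m hess f x) u| <= e / 2 * t ^+ 2].
  apply: (@filter_ex _ 0^'+); near=> t; split.
  - by near: t; exact: nbhs_right_gt.
  - by near: t; exact: second_difference.
  - by near: t; exact: second_difference.
have t20 : 0 < t ^+ 2 by rewrite exprn_gt0.
rewrite addr0 -(ler_pM2l t20) -[X in X * `|_|]gtr0_norm// -normrM.
rewrite (addrAC x (t *: v)) in h2.
move: h1 h2; rewrite !ler_norml => /andP[? ?] /andP[? ?].
by apply/andP; split; lra.
Unshelve. all: by end_near. Qed.

End Gradient.

(** * Ultrafilter form of compactness *)

Section Ultrafilter.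

(** If [A] lies in a finer proper filter [G], the complement of its preimage cannot lie in [F],
    since [G] would contain [A] and its complement. *)
Lemma fmap_ultra (T U : Type) (h : T -> U) (F : set_system T) :
  UltraFilter F -> UltraFilter (h @ F).
Proof.
move=> FU; split; first exact: fmap_proper_filter.
move=> G GF hFG; apply/seteqP; split; last exact: hFG.
move=> A GA; have [//|FnA] := in_ultra_setVsetC (h @^-1` A) FU.
have /(filterI GA) : G (~` A) by apply: hFG.
by rewrite setICr => /filter_ex[].
Qed.

(** Bolzano-Weierstrass: the image ultrafilter contains a closed ball, which is compact. *)
Lemma ultra_cvg_bounded (R : realType) (n : nat) (T : Type) (F : set_system T)
    (h : T -> 'rV[R]_n) (M : R) :
  UltraFilter F -> (\forall j \near F, `|h j| <= M) ->
  exists y : 'rV[R]_n, h @ F --> y.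
Proof.
move=> FU hM; have hU := fmap_ultra h FU.
pose A := [set y : 'rV[R]_n | `|y| <= M].
have Acl : closed A.
  apply: (@closed_comp _ _ (fun y : 'rV[R]_n => `|y|) [set r | r <= M]).
    by move=> y _; exact: norm_continuous.
  exact: closed_le.
have Abd : bounded_set A.
  exists M; split; first exact: num_real.
  by move=> M' MM' y /le_trans; apply; exact: ltW.
have := bounded_closed_compact Abd Acl; rewrite compact_ultra.
by move=> /(_ _ hU hM)[y [_ ?]]; exists y.
Qed.

End Ultrafilter.

(** * Coercivity of the model and stability of its minimizers *)

Section Envelope.
Context {R : realType} {n : nat}.
Implicit Types (f : 'rV[R]_n -> R) (g : 'rV[R]_n -> \bar R)
  (x y z v : 'rV[R]_n) (p gamma : R).

(** Gathers the finite terms in one real number, leaving [g y] as the only extended real. *)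
Lemma fb_modelE p gamma f g x y : fb_model p gamma f g x y =
  ((f x + dotp (grad f x) (y - x)
    + (p * gamma)^-1 * enorm (x - y) `^ p)%:E + g y)%E.
Proof. by rewrite /fb_model addeAC -EFinD. Qed.

Lemma fb_model_le p gamma f g x y (r : R) :
  (fb_model p gamma f g x y <= r%:E)%E ->
  (g y <= (r - (f x + dotp (grad f x) (y - x)
                + (p * gamma)^-1 * enorm (x - y) `^ p))%:E)%E.
Proof.
rewrite fb_modelE; case: (g y) => [s| |]; rewrite ?leNye//.
by rewrite -EFinD !lee_fin lerBrDl.
Qed.

(** Some admissible [gamma'] exceeds [gamma], and [c] is [(p * gamma')^-1]. The strict inequality
    between the two coefficients is the source of coercivity. *)
Lemma prox_minorant p g gamma : 1 < p -> 0 < gamma ->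
  (gamma%:E < prox_threshold p g)%E ->
  exists c b x0, [/\ 0 < c, c < (p * gamma)^-1 &
    forall y, ((b - c * enorm (x0 - y) `^ p)%:E <= g y)%E].
Proof.
move=> p1 gamma0 /ereal_sup_gt[_ [gamma' [gamma'0 [x0 infx0]] <-]].
rewrite lte_fin => lt_gamma.
have p0 : 0 < p by lra.
have [b binf] : exists b : R, (b%:E <= ereal_inf
    [set g y + ((p * gamma')^-1 * enorm (x0 - y) `^ p)%:E | y in setT])%E.
  (* When the infimum is [+oo], any real is a lower bound and 0 is chosen. *)
  by move: infx0; case: ereal_inf => [s| |]//; [exists s|exists 0; rewrite leey].
exists (p * gamma')^-1, b, x0; split.
- by rewrite invr_gt0 mulr_gt0.
- by rewrite ltf_pV2 ?posrE ?mulr_gt0// ltr_pM2l.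
- move=> y; have : (b%:E <= g y + ((p * gamma')^-1 * enorm (x0 - y) `^ p)%:E)%E.
    by apply: le_trans binf _; apply: ereal_inf_lbound; exists y.
  by case: (g y) => [s| |]; rewrite ?leey// -EFinD !lee_fin lerBlDr.
Qed.

Lemma fb_model_coercive p gamma f g (D G K : R) :
  1 < p -> 0 < gamma -> (gamma%:E < prox_threshold p g)%E ->
  exists B : R, forall x y, enorm x <= D -> enorm (grad f x) <= G ->
    `|f x| <= K -> (fb_model p gamma f g x y <= K%:E)%E -> enorm (x - y) <= B.
Proof.
move=> p1 gamma0 /(prox_minorant p1 gamma0)[c [b [x0 [c0 cc gmin]]]].
have cc0 : 0 < c < (p * gamma)^-1 by rewrite c0.
(* [K + K - b] combines the model bound [K], the bound [f x >= - K] and the constant of the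
   minorant; [G] bounds the linear term, and [enorm x0 + D] the shift of center from [x0] to [x].
   Absolute values supply the required signs. *)
have [B hB] := powR_coercive p1 cc0 (normr_ge0 (enorm x0 + D)) (normr_ge0 G)
  (normr_ge0 (K + K - b)).
exists B => x y xD gG fK /fb_model_le /(le_trans (gmin y)).
rewrite lee_fin => h.
apply: (hB (enorm (x0 - y))); rewrite ?enorm_ge0//.
  have -> : x0 - y = (x - y) + (x0 - x) by rewrite [RHS]addrC addrA subrK.
  apply: le_trans (ler_enormD _ _) _; rewrite lerD2l.
  apply: le_trans (ler_enormD _ _) _; rewrite enormN.
  by apply: le_trans _ (ler_norm _); rewrite lerD2l.
have gx : - (`|G| * enorm (x - y)) <= dotp (grad f x) (y - x).
  rewrite -(opprB x y) dotpNr lerN2; apply: le_trans (dotp_le_enorm _ _) _.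
  by rewrite ler_wpM2r ?enorm_ge0// (le_trans gG)// ler_norm.
have := ler_norm (K + K - b); move: fK; rewrite ler_norml => /andP[fK _].
move: h gx fK; set t := enorm (x - y) `^ p; set s := enorm (x0 - y) `^ p; lra.
Qed.

(** Moving base points and inexact values [a j] let one statement give both existence of minimizers
    (constant base point, minimizing sequence) and their stability (exact minimizers at [xs j]). *)
Lemma fb_splitting_cvg p gamma f g x (T : topologicalType) (F : set_system T)
    (xs ys : T -> 'rV[R]_n) (a : T -> R) (r : R) :
  1 < p -> 0 < gamma -> (gamma%:E < prox_threshold p g)%E ->
  (forall y, g y != -oo%E) -> lower_semicontinuous g ->
  {for x, continuous f} -> {for x, continuous (grad f)} ->
  UltraFilter F -> xs @ F --> x -> a @ F --> r ->
  fb_envelope p gamma f g x = r%:E ->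
  (\forall j \near F, (fb_model p gamma f g (xs j) (ys j) <= (a j)%:E)%E) ->
  exists2 y, fb_splitting p gamma f g x y & ys @ F --> y.
Proof.
move=> p1 gamma0 gammalt gNy glsc fc gc FU xsx ar envx modle.
have fxs : f \o xs @ F --> f x by exact: continuous_cvg.
have gxs : grad f \o xs @ F --> grad f x by exact: continuous_cvg.
have [y ysy] : exists y : 'rV[R]_n, ys @ F --> y.
  (* Eventually bounds both [|f (xs j)|] and [a j], as coercivity requires. *)
  pose K := `|f x| + 1 + (`|r| + 1).
  have [B hB] := fb_model_coercive f (enorm x + 1) (enorm (grad f x) + 1) K
    p1 gamma0 gammalt.
  apply: (@ultra_cvg_bounded _ _ _ F ys (B + (enorm x + 1))).
  have nxs : enorm \o xs @ F --> enorm x by exact: cvg_enorm.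
  have ngxs : enorm \o (grad f \o xs) @ F --> enorm (grad f x) by exact: cvg_enorm.
  have nfxs : Num.norm \o (f \o xs) @ F --> `|f x| by exact: cvg_norm.
  near=> j.
  have xD : enorm (xs j) <= enorm x + 1.
    by near: j; apply: (cvgr_le _ nxs); rewrite ltrDl.
  apply: le_trans (ler_norm_enorm _) _.
  have -> : ys j = - (xs j - ys j) + xs j by rewrite opprB subrK.
  apply: le_trans (ler_enormD _ _) _; rewrite enormN lerD//.
  apply: hB => //.
  - by near: j; apply: (cvgr_le _ ngxs); rewrite ltrDl.
  - apply: (@le_trans _ _ (`|f x| + 1)); last by rewrite lerDl addr_ge0.
    by near: j; apply: (cvgr_le _ nfxs); rewrite ltrDl.
  - apply: (@le_trans _ _ (a j)%:E); first by near: j.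
    rewrite lee_fin; apply: (@le_trans _ _ (`|r| + 1)); last first.
      by rewrite lerDr addr_ge0.
    by near: j; apply: (cvgr_le _ ar); rewrite (le_lt_trans (ler_norm r))// ltrDl.
exists y; last exact: ysy.
move=> z.
have le_env : (fb_envelope p gamma f g x <= fb_model p gamma f g x z)%E.
  by apply: ereal_inf_lbound; exists z.
apply: le_trans le_env; rewrite envx.
pose L u w := f u + dotp (grad f u) (w - u) + (p * gamma)^-1 * enorm (u - w) `^ p.
have Ls : (fun j => L (xs j) (ys j)) @ F --> L x y.
  apply: cvgD; first apply: cvgD => //.
    by apply: cvg_dotp; [exact: gxs|exact: cvgB].
  apply: cvgMl_tmp; apply: cvg_powR.
  - lra.
  - by move=> j; exact: enorm_ge0.
  - exact: enorm_ge0.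
  - exact: cvg_enormB.
have aLs : (fun j => a j - L (xs j) (ys j)) @ F --> r - L x y by exact: cvgB.
(* Lower semicontinuity gives [s < g (ys j)] eventually, while the model bound gives
   [g (ys j) <= a j - L (xs j) (ys j)]; the limit is taken for each real [s] below [g y]. *)
have below (s : R) : (s%:E < g y)%E -> s <= r - L x y.
  move=> /glsc[V Vy sV].
  apply: (@ler_cvg_to _ F _ _ (fun=> s) _ _ _ (cvg_cst s) aLs).
  near=> j; rewrite -lee_fin; apply: (@le_trans _ _ (g (ys j))).
    apply/ltW/sV; near: j; exact: ysy.
  by apply: fb_model_le; near: j.
have : (g y <= (r - L x y)%:E)%E.
  have := gNy y; case: (g y) below => [s| |]// below _.
    rewrite lee_fin; apply/ler_addgt0Pr => e e0.
    by rewrite -lerBlDr; apply: below; rewrite lte_fin ltrBlDr ltrDl.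
  (* [g y = +oo] is impossible, as every real would then be at most [r - L x y]. *)
  by have := below (r - L x y + 1) (ltry _); rewrite gerDl ler10.
rewrite fb_modelE -/(L x y); have := gNy y; case: (g y) => [s _| |]//.
by rewrite -EFinD !lee_fin lerBrDl.
Unshelve. all: by end_near. Qed.

Lemma fb_splitting_nonempty p gamma f g x :
  1 < p -> 0 < gamma -> (gamma%:E < prox_threshold p g)%E ->
  (forall y, g y != -oo%E) -> lower_semicontinuous g ->
  {for x, continuous f} -> {for x, continuous (grad f)} ->
  fb_envelope p gamma f g x \is a fin_num ->
  exists y, fb_splitting p gamma f g x y.
Proof.
move=> p1 gamma0 gammalt gNy glsc fc gc /fineK; set r := fine _ => envx.
have /choice[ys hys] : forall j : nat, exists y,
    (fb_model p gamma f g x y < (r + harmonic j)%:E)%E.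
  move=> j; have : (fb_envelope p gamma f g x < (r + harmonic j)%:E)%E.
    by rewrite -envx lte_fin ltrDl harmonic_gt0.
  by move=> /ereal_inf_lt[_ [y _ <-] ?]; exists y.
have [F [FU Foo]] := @ultraFilterLemma nat \oo _.
have ar : (fun j => r + harmonic j) @ F --> r.
  have : (fun j => r + harmonic j) @ \oo --> r + 0.
    by apply: cvgD; [exact: cvg_cst|exact: cvg_harmonic].
  by rewrite addr0 => h A /h /Foo.
have xx : (fun _ : nat => x) @ F --> x by exact: cvg_cst.
have modle : \forall j \near F,
    (fb_model p gamma f g x (ys j) <= (r + harmonic j)%:E)%E.
  by apply: nearW => j; exact: ltW.
have [y yx _] := fb_splitting_cvg p1 gamma0 gammalt gNy glsc fc gc FU xx ar
  (esym envx) modle.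
by exists y.
Qed.

End Envelope.

(** * Frechet subgradients of the envelope *)

Section Subgradient.
Context {R : realType} {n : nat}.
Implicit Types (f : 'rV[R]_n -> R) (g psi : 'rV[R]_n -> \bar R)
  (x y z v zeta : 'rV[R]_n) (p gamma : R).

Lemma cvg_line x v : (fun t : R => x + t *: v) @ 0^'+ --> x.
Proof.
have : (fun t : R => x + t *: v) @ 0^'+ --> x + 0 *: v.
  apply: cvgD; first exact: cvg_cst.
  by apply: cvgZr_tmp; apply: cvg_at_right_filter; exact: cvg_id.
by rewrite scale0r addr0.
Qed.

Lemma cvg_dnbhs_line x v : v != 0 -> (fun t : R => x + t *: v) @ 0^'+ --> x^'.
Proof.
move=> v0 A /(@cvg_line x v) xA.
have {}xA : \forall t \near (0 : R)^'+, x + t *: v != x -> A (x + t *: v) by [].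
suff: \forall t \near (0 : R)^'+, A (x + t *: v) by [].
near=> t; have : x + t *: v != x -> A (x + t *: v) by near: t.
apply; rewrite -[X in _ != X]addr0 (inj_eq (addrI x)) scaler_eq0 negb_or v0 andbT.
by rewrite gt_eqF//; near: t; exact: nbhs_right_gt.
Unshelve. all: by end_near. Qed.

Lemma cvg_right_quotient (W : normedModType R) (F : 'rV[R]_n -> W) x v :
  differentiable F x ->
  (fun t : R => t^-1 *: (F (x + t *: v) - F x)) @ 0^'+ --> 'd F x v.
Proof.
move=> dF; rewrite -deriveE//.
have /cvg_dnbhs_at_right : (fun t : R => t^-1 *: ((F \o shift x) (t *: v) - F x))
    @ 0^' --> 'D_v F x by exact: diff_derivable.
suff -> : (fun t : R => t^-1 *: ((F \o shift x) (t *: v) - F x))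
        = (fun t : R => t^-1 *: (F (x + t *: v) - F x)) by [].
by apply/funext => t /=; rewrite (addrC (t *: v)).
Qed.

(** Quantifying over real majorants [m] keeps the inequality among reals; the model with its
    minimizer held fixed will supply [m]. *)
Lemma frechet_subdiff_line psi x zeta v : v != 0 -> frechet_subdiff psi x zeta ->
  forall e : R, 0 < e -> \forall t \near (0 : R)^'+, forall m : R,
    (psi (x + t *: v)%R <= m%:E)%E ->
    t * dotp zeta v - e * t <= m - fine (psi x).
Proof.
move=> v0 [psix]; rewrite limf_einfE => einf e e0.
have nv : 0 < enorm v.
  rewrite lt_def enorm_ge0 andbT; apply: contra_neq v0; exact: enorm0_eq0.
have : ((- (e / enorm v))%:E < 0)%E by rewrite lte_fin oppr_lt0 divr_gt0.
move=> /lt_le_trans /(_ einf) /ereal_sup_gt[_ [A Ax <-] infA].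
have {}Ax : \forall t \near (0 : R)^'+, A (x + t *: v).
  by have := @cvg_dnbhs_line x v v0 A Ax.
near=> t => m psim.
have t0 : 0 < t by near: t; exact: nbhs_right_gt.
have At : A (x + t *: v) by near: t.
have : ((- (e / enorm v))%:E <
    (psi (x + t *: v)%R - psi x - (dotp zeta (x + t *: v - x)%R)%:E)
    * ((enorm (x + t *: v - x)%R)^-1)%:E)%E.
  by apply: lt_le_trans infA _; apply: ereal_inf_lbound; exists (x + t *: v).
have tv : enorm (x + t *: v - x) = t * enorm v.
  by rewrite addrAC subrr add0r enormZ gtr0_norm.
rewrite tv (_ : x + t *: v - x = t *: v); last by rewrite addrAC subrr add0r.
rewrite dotpZr -(fineK psix); move: psim; case: (psi (x + t *: v)%R) => [s| |]//.
  rewrite lee_fin => sm; rewrite -!EFinB -EFinM lte_fin.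
  rewrite ltr_pdivlMr ?mulr_gt0// => h.
  have : - (e / enorm v) * (t * enorm v) = - (e * t) by field; rewrite gt_eqF.
  move=> E; rewrite E in h; lra.
(* If [psi] were [-oo] at the moved point, the quotient would be [-oo], below the strict lower
   bound. *)
by rewrite /= gt0_mulNye ?lte_fin ?invr_gt0 ?mulr_gt0// ltNge leNye.
Unshelve. all: by end_near. Qed.

(** The transpose arises because the derivative of [grad f] along [v], which is [v *m hess f x], is
    paired with [y - x], and [v] must then be isolated. *)
Lemma fb_subgradient p gamma f g x y zeta :
  1 < p -> 0 < gamma -> (forall z, g z != -oo%E) ->
  (forall z, differentiable f z) -> differentiable (grad f) x ->
  fb_splitting p gamma f g x y ->
  frechet_subdiff (fb_envelope p gamma f g) x zeta ->
  zeta = (y - x) *m (hess f x)^T + gamma^-1 *: pow_dual p (x - y).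
Proof.
move=> p1 gamma0 gNy df dg xy sub.
set rhs := (X in _ = X); apply: dotp_inj => v.
have [->|v0] := eqVneq v 0; first by rewrite !dotp0r.
apply/ler_addgt0Pr => e e0; rewrite -lerBlDr.
have envE : fb_envelope p gamma f g x = fb_model p gamma f g x y.
  apply/eqP; rewrite eq_le; apply/andP; split.
    exact: ereal_inf_lbound (imageT _ y).
  by apply/ereal_infP => _ [z _ <-]; exact: xy.
have [envfin _] := sub.
have [s gys] : exists s, g y = s%:E.
  have := gNy y; move: envfin; rewrite envE fb_modelE.
  by case: (g y) => [s| |]//; exists s.
pose c := (p * gamma)^-1.
have p0 : 0 < p by lra.
have cp : c * p = gamma^-1.
  by rewrite /c invfM mulrC mulrA mulfV ?gt_eqF// mul1r.
have c0 : 0 < c by rewrite invr_gt0 mulr_gt0.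
have scale_convex (t d a b : R) : c * (b + p * - (t * d)) <= c * a ->
    c * b - c * a <= t * (c * p * d) by lra.
have combine (t q fz fx d d1 d0 a b w u : R) :
    t * q - e * t <= fz + d + b + s - (fx + d0 + a + s) ->
    d = d1 - t * u -> b - a <= t * w ->
    t * q - t * e <= fz - fx + (d1 - d0) - t * u + t * w by lra.
(* Upper bound for the difference quotient of the model along [v], with [y] fixed. In the limit the
   first and third terms cancel, leaving [dotp rhs v]. *)
pose Q (t : R) := t^-1 *: (f (x + t *: v) - f x)
  + dotp (t^-1 *: (grad f (x + t *: v) - grad f x)) (y - x)
  - dotp (grad f (x + t *: v)) v
  + gamma^-1 * dotp (pow_dual p (x + t *: v - y)) v.
have Qrhs : Q @ 0^'+ --> dotp rhs v.
  have -> : dotp rhs v = 'd f x v + dotp ('d (grad f) x v) (y - x)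
      - dotp (grad f x) v + gamma^-1 * dotp (pow_dual p (x - y)) v.
    rewrite /rhs dotpDl dotpZl dotp_mulmx trmxK -mulmx_hess -dotp_grad.
    by rewrite (dotpC (y - x)); ring.
  have xt := @cvg_line x v.
  apply: cvgD; first apply: cvgB; first apply: cvgD.
  - exact: cvg_right_quotient.
  - apply: cvg_dotp; [exact: cvg_right_quotient|exact: cvg_cst].
  - apply: cvg_dotp; last exact: cvg_cst.
    apply: (@continuous_cvg _ _ _ _ _ _ (grad f)) => //.
    exact: differentiable_continuous.
  - apply: cvgMl_tmp; apply: cvg_dotp; last exact: cvg_cst.
    by apply: cvg_pow_dual => //; apply: cvgB => //; exact: cvg_cst.
have subv := frechet_subdiff_line v0 sub e0.
apply: (@ler_cvg_to R 0^'+ _ _ (fun=> dotp zeta v - e) Q _ _ (cvg_cst _) Qrhs).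
near=> t.
have t0 : 0 < t by near: t; exact: nbhs_right_gt.
have [z zE] : exists z, x + t *: v = z by exists (x + t *: v).
have envz : (fb_envelope p gamma f g z <=
    (f z + dotp (grad f z) (y - z) + c * enorm (z - y) `^ p + s)%:E)%E.
  apply: (@le_trans _ _ (fb_model p gamma f g z y)).
    exact: ereal_inf_lbound (imageT _ y).
  by rewrite fb_modelE gys -EFinD -/c.
have /(_ _ envz) : forall m : R, (fb_envelope p gamma f g z <= m%:E)%E ->
    t * dotp zeta v - e * t <= m - fine (fb_envelope p gamma f g x).
  by rewrite -zE; near: t.
rewrite envE fb_modelE gys -EFinD /= -/c => h.
(* Convexity with base point [z - y] bounds the increase of the power term by its slope at the moved
   point; that slope converges as [t] tends to 0. *)
have cvx := enorm_powR_convex (x - y) (z - y) p1.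
have {}cvx : c * enorm (z - y) `^ p - c * enorm (x - y) `^ p
    <= t * (gamma^-1 * dotp (pow_dual p (z - y)) v).
  have zx : x - y - (z - y) = - (t *: v).
    by rewrite -zE; apply/rowP => i; rewrite !mxE; ring.
  move: cvx; rewrite zx dotpNr dotpZr -cp -(ler_pM2l c0).
  exact: scale_convex.
rewrite -(ler_pM2l t0) mulrBr.
have -> : t * Q t = (f z - f x)
    + (dotp (grad f z) (y - x) - dotp (grad f x) (y - x))
    - t * dotp (grad f z) v + t * (gamma^-1 * dotp (pow_dual p (z - y)) v).
  have alg (a b d q r : R) :
      t * (t^-1 * a + t^-1 * (b - d) - q + r) = a + (b - d) - t * q + t * r.
    by field; rewrite gt_eqF.
  by rewrite /Q zE dotpZl dotpBl; exact: alg.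
have yz : dotp (grad f z) (y - z) = dotp (grad f z) (y - x) - t * dotp (grad f z) v.
  by rewrite -dotpZr -dotpBr -zE opprD addrA.
exact: combine h yz cvx.
Unshelve. all: by end_near. Qed.

End Subgradient.

(** * Passage of the subgradient formula to the limit *)

Theorem corollary26 (R : realType) (n : nat) (p : R)
  (g : 'rV[R]_n -> \bar R) (f : 'rV[R]_n -> R)
  (xbar : 'rV[R]_n) (U : set 'rV[R]_n) (gamma : R)
  (hp : 1 < p)
  (gNy : forall x, g x != -oo%E)
  (gproper : proper_fun g)
  (glsc : lower_semicontinuous g)
  (gprox : prox_bounded p g)
  (fdiff : forall x, differentiable f x)
  (phi_fin : ((f xbar)%:E + g xbar < +oo)%E)
  (Uopen : open U) (Uxbar : U xbar)
  (fC2 : C2_on U f)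
  (gamma_gt0 : 0 < gamma)
  (gamma_lt : (gamma%:E < prox_threshold p g)%E) :
  limiting_subdiff (fb_envelope p gamma f g) xbar `<=`
  \bigcup_(ybar in fb_splitting p gamma f g xbar)
    [set (ybar - xbar) *m hess f xbar
         + gamma^-1 *: pow_dual p (xbar - ybar)].
Proof.
move=> zeta [envfin [xs [zs [xsx sub envs zsz]]]].
have fc x : {for x, continuous f} by exact: differentiable_continuous.
have dg x : U x -> differentiable (grad f) x by move=> /fC2[].
have gc x : U x -> {for x, continuous (grad f)}.
  by move=> /dg; exact: differentiable_continuous.
(* Minimizers are selected where [xs k] lies in [U], which holds eventually; elsewhere the value is
   a dummy 0. *)
have /choice[ys hys] : forall k, exists y,
    U (xs k) -> fb_splitting p gamma f g (xs k) y.
  move=> k; have [Uk|] := pselect (U (xs k)); last by exists 0.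
  have [fin _] := sub k.
  have [y hy] := fb_splitting_nonempty hp gamma_gt0 gamma_lt gNy glsc (fc _)
    (gc _ Uk) fin.
  by exists y.
have [F [FU Foo]] := @ultraFilterLemma nat \oo _.
have toF (T : topologicalType) (h : nat -> T) (l : T) : h @ \oo --> l -> h @ F --> l.
  by move=> hl A /hl /Foo.
have xsF : xs @ F --> xbar by exact: toF.
have zsF : zs @ F --> zeta by exact: toF.
have UF : \forall k \near F, U (xs k) by exact: (xsF _ (open_nbhs_nbhs (conj Uopen Uxbar))).
have envF : (fine \o (fb_envelope p gamma f g \o xs)) @ F
    --> fine (fb_envelope p gamma f g xbar).
  by apply: toF; apply: fine_cvg; rewrite fineK.
have modF : \forall k \near F, (fb_model p gamma f g (xs k) (ys k)
    <= ((fine \o (fb_envelope p gamma f g \o xs)) k)%:E)%E.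
  apply: filterS UF => k Uk /=; have [fin _] := sub k; rewrite fineK//.
  by apply/ereal_infP => _ [z _ <-]; exact: hys.
have [y yx ysy] := fb_splitting_cvg hp gamma_gt0 gamma_lt gNy glsc (fc xbar)
  (gc _ Uxbar) FU xsF envF (esym (fineK envfin)) modF.
exists y => //=.
have hessF : hess f \o xs @ F --> hess f xbar.
  by apply: continuous_cvg => //; have [] := fC2 _ Uxbar.
(* Symmetry brings the target to the transposed form of the subgradient formula. *)
rewrite -[X in _ *m X](hess_sym fdiff (dg _ Uxbar)).
apply/rowP => i.
have zi : (fun k => zs k 0 i) @ F --> zeta 0 i by exact: cvg_coord.
pose w (x z : 'rV[R]_n) (A : 'M[R]_n) := (z - x) *m A^T + gamma^-1 *: pow_dual p (x - z).
(* Entry by entry, [zs k] has limit [zeta] and eventually equals the formula at [xs k] and [ys k],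
   so uniqueness of limits concludes. *)
suff : (fun k => zs k 0 i) @ F --> w xbar y (hess f xbar) 0 i.
  exact: cvg_unique zi.
have wF : (fun k => w (xs k) (ys k) (hess f (xs k)) 0 i) @ F
    --> w xbar y (hess f xbar) 0 i.
  rewrite /w mxE [X in _ + X]mxE; under eq_fun do rewrite mxE [X in _ + X]mxE.
  apply: cvgD.
    apply: (@cvg_mulmx_trmx _ _ _ _ _ _ _ (fun k => ys k - xs k)) => //.
    exact: cvgB.
  apply: cvgMl_tmp; apply: (@cvg_coord _ _ _ _ _ _ (fun k => pow_dual p (xs k - ys k))).
  by apply: cvg_pow_dual => //; exact: cvgB.
apply: cvg_trans wF; apply: near_eq_cvg; apply: filterS UF => k Uk.
by rewrite (fb_subgradient hp gamma_gt0 gNy fdiff (dg _ Uk) (hys k Uk) (sub k)).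
Qed.
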